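(* Let $a\in\mathbb C$ and $j\in\mathbb Z$. The graded subspaces of $\mathcal{SD}^{\sigma_{+-,a}}$ of degrees $j$ and $j-\frac12$ are $$\mathcal{SD}^{\sigma_{+-,a}}_j=\{\partial_\theta\theta\, t^jf(D)-\theta\partial_\theta\, t^jf(-D-j+a)\mid f\in\mathbb C[w]\},$$ $$\mathcal{SD}^{\sigma_{+-,a}}_{j-1/2}=\{\theta\, t^{j-1}f(D+(j-a-1)/2)+\partial_\theta\, t^jg(D+(j-a)/2)\mid f\in\mathbb C^{(0)}[w],\ g\in\mathbb C^{(1)}[w]\}.$$
   Context: $\mathcal{SD}$ is the Lie superalgebra (supercommutator bracket) of the associative superalgebra over $\mathbb C$ generated by even $t^{\pm1}$, $D=t\frac{d}{dt}$ and odd $\theta,\partial_\theta$, with $f(D)t=tf(D+1)$, $\theta^2=\partial_\theta^2=0$, $\theta\partial_\theta+\partial_\theta\theta=1$, $\theta,\partial_\theta$ commuting with $t,D$. It has basis $t^kD^l$ ($k\in\mathbb Z,l\ge0$) times $\theta\partial_\theta,\partial_\theta\theta,\theta,\partial_\theta$. It is $\frac12\mathbb Z$-graded (principal gradation) by $wt(t)=1$, $wt(D)=0$, $wt(\theta)=\frac12$, $wt(\partial_\theta)=-\frac12$. The anti-involution $\sigma_{+-,a}$ is the $\mathbb C$-linear map with $\sigma(XY)=(-1)^{|X||Y|}\sigma(Y)\sigma(X)$ determined by $t\mapsto t$, $D\mapsto-D+a$, $\theta\mapsto-\theta$, $\partial_\theta\mapsto\partial_\theta$. For an anti-involution $\sigma$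 put $\mathcal{SD}^\sigma=\{e\in\mathcal{SD}\mid\sigma(e)=-e\}$, graded by the principal gradation. $\mathbb C^{(0)}[w]$ (resp. $\mathbb C^{(1)}[w]$) is the space of even (resp. odd) polynomials in $w$. *)

(* Defs.v *)
From HB Require Import structures.
From mathcomp Require Import all_boot all_order all_algebra.
From mathcomp Require Import finmap monalg complex.
From mathcomp Require Import boolp classical_sets reals.

Set Implicit Arguments.
Unset Strict Implicit.
Unset Printing Implicit Defensive.

Import GRing.Theory.
Local Open Scope ring_scope.

(* The associative algebra generated by t, t^-1 and D with f(D) t = t f(D + 1):
   the coefficient g@_k : {poly C} of g stands for the summand t^k g@_k(D). *)
Definition LD (C : comNzRingType) : Type := {malg {poly C}[int]}.

Section LaurentDiff.
Variable C : comNzRingType.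

HB.instance Definition _ := GRing.Zmodule.on (LD C).

(* t^k f(D) *)
Definition LDmon (k : int) (f : {poly C}) : LD C := << f *g k >>.

Definition shiftp (l : int) (f : {poly C}) : {poly C} := f \Po ('X + l%:~R).

Lemma LDmonE k f l : (LDmon k f)@_l = f *+ (k == l).
Proof. exact: mcoeffU. Qed.
Lemma LDmon0 k : LDmon k 0 = 0. Proof. exact: monalgU0. Qed.
Lemma LDmonD k : {morph LDmon k : f g / f + g}. Proof. exact: monalgUD. Qed.

Lemma shiftpD l : {morph shiftp l : f g / f + g}.
Proof. by move=> f g; rewrite /shiftp comp_polyD. Qed.
Lemma shiftpM l : {morph shiftp l : f g / f * g}.
Proof. by move=> f g; rewrite /shiftp comp_polyM. Qed.
Lemma shiftp0 l : shiftp l 0 = 0. Proof. exact: comp_poly0. Qed.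
Lemma shiftp1 l : shiftp l 1 = 1. Proof. by rewrite /shiftp -polyC1 comp_polyC. Qed.
Lemma shift0p f : shiftp 0 f = f.
Proof. by rewrite /shiftp addr0 comp_polyXr. Qed.
Lemma shiftp_shift l m f : shiftp m (shiftp l f) = shiftp (l + m) f.
Proof.
rewrite /shiftp -comp_polyA comp_polyD comp_polyX.
by rewrite rmorph_int rmorphD /= addrAC -addrA.
Qed.

(* t^k f(D) t^l g(D) = t^(k+l) f(D + l) g(D) *)
Definition LD_mul (g1 g2 : LD C) : LD C :=
  \sum_(k <- msupp g1) \sum_(l <- msupp g2)
    LDmon (k + l) (shiftp l g1@_k * g2@_l).

Definition LD_one : LD C := LDmon 0 1.
Definition LD_scale (c : C) (g : LD C) : LD C := c%:P *: (g : {malg {poly C}[int]}).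


Lemma LD_mulw (d1 d2 : {fset int}) (g1 g2 : LD C) :
  (msupp g1 `<=` d1)%fset -> (msupp g2 `<=` d2)%fset ->
  LD_mul g1 g2 =
    \sum_(k <- d1) \sum_(l <- d2) LDmon (k + l) (shiftp l g1@_k * g2@_l).
Proof.
move=> le_d1 le_d2; rewrite /LD_mul (big_fset_incl _ le_d1) /=.
  apply/eq_bigr=> k1 _; apply/big_fset_incl => // k _ /mcoeff_outdom ->.
  by rewrite mulr0 LDmon0.
move=> k _ /mcoeff_outdom g1k.
by rewrite big1 => // k' _; rewrite g1k shiftp0 mul0r LDmon0.
Qed.

Lemma LD_mulUU k l (f g : {poly C}) :
  LD_mul (LDmon k f) (LDmon l g) = LDmon (k + l) (shiftp l f * g).
Proof. by rewrite (LD_mulw msuppU_le msuppU_le) !big_seq_fset1 !mcoeffUU. Qed.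

Lemma LD_mulDl : left_distributive LD_mul +%R.
Proof.
move=> g1 g2 g; pose d := (msupp g1 `|` msupp g2)%fset.
rewrite (@LD_mulw d (msupp g) (g1 + g2) g) ?msuppD_le //.
rewrite (@LD_mulw d (msupp g) g1 g) ?fsubsetUl //.
rewrite (@LD_mulw d (msupp g) g2 g) ?fsubsetUr //.
rewrite -big_split /=; apply/eq_bigr=> k1 _.
rewrite -big_split /=; apply/eq_bigr=> k2 _.
by rewrite mcoeffD shiftpD mulrDl LDmonD.
Qed.

Lemma LD_mulDr : right_distributive LD_mul +%R.
Proof.
move=> g g1 g2; pose d := (msupp g1 `|` msupp g2)%fset.
rewrite (@LD_mulw (msupp g) d g (g1 + g2)) ?msuppD_le //.
rewrite (@LD_mulw (msupp g) d g g1) ?fsubsetUl //.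
rewrite (@LD_mulw (msupp g) d g g2) ?fsubsetUr //.
rewrite -big_split /=; apply/eq_bigr=> k1 _.
rewrite -big_split /=; apply/eq_bigr=> k2 _.
by rewrite mcoeffD mulrDr LDmonD.
Qed.

Lemma LD_mul0l : left_zero 0 LD_mul.
Proof. by move=> g; rewrite /LD_mul msupp0 big_seq_fset0. Qed.

Lemma LD_mul0r : right_zero 0 LD_mul.
Proof.
by move=> g; rewrite /LD_mul msupp0 big1 // => k _; rewrite big_seq_fset0.
Qed.

Lemma LD_sumE (g : LD C) : g = \sum_(k <- msupp g) LDmon k g@_k.
Proof. exact: monalgE. Qed.

Lemma LD_ind (P : LD C -> Prop) :
    P 0 -> (forall x y, P x -> P y -> P (x + y)) ->
    (forall k f, P (LDmon k f)) -> forall g, P g.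
Proof.
by move=> P0 PD Pm g; rewrite (LD_sumE g); apply: (big_ind P) => // k _.
Qed.

Lemma LD_mulA : associative LD_mul.
Proof.
move=> g1 g2 g3; elim/LD_ind: g1 => [|x y IHx IHy|k f].
- by rewrite !LD_mul0l.
- by rewrite !LD_mulDl IHx IHy.
elim/LD_ind: g2 => [|x y IHx IHy|l g].
- by rewrite LD_mul0l LD_mul0r LD_mul0l.
- by rewrite LD_mulDl !LD_mulDr LD_mulDl IHx IHy.
elim/LD_ind: g3 => [|x y IHx IHy|m h]; first by rewrite !LD_mul0r.
- by rewrite !LD_mulDr IHx IHy.
by rewrite !LD_mulUU shiftpM shiftp_shift !mulrA addrA.
Qed.

Lemma LD_mul1l : left_id LD_one LD_mul.
Proof.
elim/LD_ind => [|x y IHx IHy|k f]; first by rewrite LD_mul0r.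
- by rewrite LD_mulDr IHx IHy.
by rewrite LD_mulUU shiftp1 mul1r add0r.
Qed.

Lemma LD_mul1r : right_id LD_one LD_mul.
Proof.
elim/LD_ind => [|x y IHx IHy|k f]; first by rewrite LD_mul0l.
- by rewrite LD_mulDl IHx IHy.
by rewrite LD_mulUU shift0p mulr1 addr0.
Qed.

Lemma LD_one_neq0 : LD_one != 0.
Proof. by rewrite monalgU_eq0 oner_neq0. Qed.

HB.instance Definition _ := GRing.Zmodule_isNzRing.Build (LD C)
  LD_mulA LD_mul1l LD_mul1r LD_mulDl LD_mulDr LD_one_neq0.

Lemma LDmonM k l (f g : {poly C}) :
  LDmon k f * LDmon l g = LDmon (k + l) (shiftp l f * g).
Proof. exact: LD_mulUU. Qed.

Lemma LD_scaleA c1 c2 g : LD_scale c1 (LD_scale c2 g) = LD_scale (c1 * c2) g.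
Proof. by rewrite /LD_scale scalerA polyCM. Qed.
Lemma LD_scale1 : left_id 1 LD_scale.
Proof. by move=> g; rewrite /LD_scale scale1r. Qed.
Lemma LD_scaleDr : right_distributive LD_scale +%R.
Proof. by move=> c g1 g2; rewrite /LD_scale scalerDr. Qed.
Lemma LD_scaleDl g : {morph LD_scale^~ g : c1 c2 / c1 + c2}.
Proof. by move=> c1 c2; rewrite /LD_scale polyCD scalerDl. Qed.

HB.instance Definition _ := GRing.Zmodule_isLmodule.Build C (LD C)
  LD_scaleA LD_scale1 LD_scaleDr LD_scaleDl.

Lemma mcoeffLZ (c : C) (g : LD C) k : (c *: g)@_k = c *: g@_k.
Proof. by rewrite [LHS]mcoeffZ mul_polyC. Qed.

Lemma LD_ZU (c : C) k f : c *: LDmon k f = LDmon k (c *: f).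
Proof. by apply/malgP => l; rewrite mcoeffLZ !LDmonE scalerMnr. Qed.

Lemma LD_scaleAl (c : C) (u v : LD C) : c *: (u * v) = c *: u * v.
Proof.
elim/LD_ind: u => [|x y IHx IHy|k f]; first by rewrite !(mul0r, scaler0).
- by rewrite !(mulrDl, scalerDr) IHx IHy.
elim/LD_ind: v => [|x y IHx IHy|l g]; first by rewrite !(mulr0, scaler0).
- by rewrite !(mulrDr, scalerDr) IHx IHy.
by rewrite LD_ZU !LDmonM LD_ZU /shiftp comp_polyZ scalerAl.
Qed.

HB.instance Definition _ := GRing.Lmodule_isLalgebra.Build C (LD C) LD_scaleAl.

Lemma LD_scaleAr (c : C) (u v : LD C) : c *: (u * v) = u * (c *: v).
Proof.
elim/LD_ind: u => [|x y IHx IHy|k f]; first by rewrite !(mul0r, scaler0).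
- by rewrite !(mulrDl, scalerDr) IHx IHy.
elim/LD_ind: v => [|x y IHx IHy|l g]; first by rewrite !(mulr0, scaler0).
- by rewrite !(mulrDr, scalerDr) IHx IHy.
by rewrite LD_ZU !LDmonM LD_ZU scalerAr.
Qed.

HB.instance Definition _ := GRing.Lalgebra_isAlgebra.Build C (LD C) LD_scaleAr.

End LaurentDiff.

(* SD is M_2(LD): theta and d_theta are the matrix units E_01 and E_10, so that
   theta d_theta = E_00 and d_theta theta = E_11, and t, D are scalar matrices. *)
Definition SD (C : comNzRingType) : Type := 'M[LD C]_2.

Section SuperAlgebra.
Variable C : comNzRingType.

HB.instance Definition _ := GRing.NzRing.on (SD C).

(* Scaling by C, not by LD C. *)
Definition SD_scale (c : C) (e : SD C) : SD C := \matrix_(i, j) (c *: e i j).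

Lemma SD_scaleA c1 c2 e : SD_scale c1 (SD_scale c2 e) = SD_scale (c1 * c2) e.
Proof. by apply/matrixP => i j; rewrite !mxE scalerA. Qed.
Lemma SD_scale1 : left_id 1 SD_scale.
Proof. by move=> e; apply/matrixP => i j; rewrite !mxE scale1r. Qed.
Lemma SD_scaleDr : right_distributive SD_scale +%R.
Proof. by move=> c e1 e2; apply/matrixP => i j; rewrite !mxE scalerDr. Qed.
Lemma SD_scaleDl e : {morph SD_scale^~ e : c1 c2 / c1 + c2}.
Proof. by move=> c1 c2; apply/matrixP => i j; rewrite !mxE scalerDl. Qed.

HB.instance Definition _ := GRing.Zmodule_isLmodule.Build C (SD C)
  SD_scaleA SD_scale1 SD_scaleDr SD_scaleDl.

Lemma SD_addE (u v : SD C) i j : (u + v) i j = u i j + v i j.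
Proof. exact: mxE. Qed.
Lemma SD_oppE (u : SD C) i j : (- u) i j = - u i j.
Proof. exact: mxE. Qed.
Lemma SD_0E i j : (0 : SD C) i j = 0.
Proof. exact: mxE. Qed.
Lemma SD_mulE (u v : SD C) i j : (u * v) i j = u i 0 * v 0 j + u i 1 * v 1 j.
Proof. by rewrite [LHS]mxE big_ord_recl big_ord1; congr (_ + u i _ * v _ j); apply/val_inj. Qed.
Lemma SD_ZE c (u : SD C) i j : (c *: u) i j = c *: u i j.
Proof. exact: mxE. Qed.

Lemma SD_eqP (u v : SD C) :
  u 0 0 = v 0 0 -> u 0 1 = v 0 1 -> u 1 0 = v 1 0 -> u 1 1 = v 1 1 -> u = v.
Proof.
move=> e00 e01 e10 e11; apply/matrixP.
have I2 (i : 'I_2) : i = 0 \/ i = 1.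
  by case: i => [[|[|//]] ?]; [left | right]; apply/val_inj.
by move=> i j; case: (I2 i) => ->; case: (I2 j) => ->.
Qed.

Lemma SD_scaleAl (c : C) (u v : SD C) : c *: (u * v) = c *: u * v.
Proof.
by apply/matrixP => i j; rewrite !(SD_ZE, SD_mulE) scalerDr !scalerAl.
Qed.

HB.instance Definition _ := GRing.Lmodule_isLalgebra.Build C (SD C) SD_scaleAl.

Lemma SD_scaleAr (c : C) (u v : SD C) : c *: (u * v) = u * (c *: v).
Proof.
by apply/matrixP => i j; rewrite !(SD_ZE, SD_mulE) scalerDr !scalerAr.
Qed.

HB.instance Definition _ := GRing.Lalgebra_isAlgebra.Build C (SD C) SD_scaleAr.

Definition SDscal (g : LD C) : SD C := g%:M.

Definition tpow (k : int) : SD C := SDscal (LDmon k 1).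
Definition Dop : SD C := SDscal (LDmon 0 'X).
Definition theta : SD C := delta_mx 0 1.
Definition dtheta : SD C := delta_mx 1 0.

End SuperAlgebra.

Arguments tpow {C} k.
Arguments Dop {C}.
Arguments theta {C}.
Arguments dtheta {C}.

Section Relations.
Variable C : comNzRingType.
Implicit Types (f : {poly C}) (g : LD C).

Lemma SDscalE g i j : SDscal g i j = g *+ (i == j).
Proof. exact: mxE. Qed.
Lemma thetaE i j : (theta : SD C) i j = ((i == 0) && (j == 1))%:R.
Proof. exact: mxE. Qed.
Lemma dthetaE i j : (dtheta : SD C) i j = ((i == 1) && (j == 0))%:R.
Proof. exact: mxE. Qed.

Lemma SDscalM g1 g2 : SDscal (g1 * g2) = SDscal g1 * SDscal g2.
Proof. exact: scalar_mxM. Qed.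

Lemma SDscal_comm (e : SD C) g :
  (forall i j, e i j * g = g * e i j) -> e * SDscal g = SDscal g * e.
Proof.
by move=> eg; apply: SD_eqP; rewrite !SD_mulE !SDscalE /=
  ?mulr1n ?mulr0n ?mulr0 ?mul0r ?addr0 ?add0r eg.
Qed.

Lemma tpow0 : tpow 0 = 1 :> SD C. Proof. by []. Qed.

Lemma tpowD k l : tpow (k + l) = tpow k * tpow l :> SD C.
Proof. by rewrite -SDscalM LDmonM shiftp1 mulr1. Qed.

Lemma horner_Dop f : horner_alg Dop f = SDscal (LDmon 0 f).
Proof.
elim/poly_ind: f => [|f c IH]; first by rewrite rmorph0 LDmon0 /SDscal raddf0.
rewrite rmorphD rmorphM /= horner_algX horner_algC IH -SDscalM LDmonM shift0p.
rewrite addr0 LDmonD /SDscal raddfD /=; congr (_ + _).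
apply: SD_eqP; rewrite !(SD_ZE, SDscalE) ?scaler0 //;
  by rewrite !mulr1n LD_ZU -alg_polyC.
Qed.

Lemma Dop_tpow f k :
  horner_alg Dop f * tpow k = tpow k * horner_alg (Dop + k%:~R) f :> SD C.
Proof.
have -> : horner_alg (Dop + k%:~R : SD C) f = horner_alg Dop (shiftp k f).
  elim/poly_ind: f => [|f c IH]; first by rewrite shiftp0 !rmorph0.
  rewrite shiftpD shiftpM !rmorphD !rmorphM /= IH !horner_algX.
  rewrite /shiftp comp_polyX comp_polyC !horner_algC.
  by rewrite rmorphD /= horner_algX rmorph_int.
by rewrite !horner_Dop -!SDscalM !LDmonM add0r addr0 shift0p mulr1 mul1r.
Qed.

Lemma thetaME (e : SD C) i j : (theta * e) i j = e 1 j *+ (i == 0).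
Proof. by rewrite SD_mulE !thetaE andbF mul0r add0r andbT mulr_natl. Qed.
Lemma dthetaME (e : SD C) i j : (dtheta * e) i j = e 0 j *+ (i == 1).
Proof. by rewrite SD_mulE !dthetaE andbF mul0r addr0 andbT mulr_natl. Qed.

Lemma unit_entry (g1 g2 g3 g4 : LD C) i j :
  (theta * dtheta * SDscal g1 + dtheta * theta * SDscal g2
   + theta * SDscal g3 + dtheta * SDscal g4) i j =
  g1 *+ (0 == j) *+ (i == 0) + g2 *+ (1 == j) *+ (i == 1)
  + g3 *+ (1 == j) *+ (i == 0) + g4 *+ (0 == j) *+ (i == 1).
Proof.
have AE (x y z w : SD C) : (x + y + z + w) i j = x i j + y i j + z i j + w i j.
  by rewrite !SD_addE.
have f4 (x1 x2 x3 x4 y1 y2 y3 y4 : LD C) : x1 = y1 -> x2 = y2 -> x3 = y3 ->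
  x4 = y4 -> x1 + x2 + x3 + x4 = y1 + y2 + y3 + y4 by move=> -> -> -> ->.
rewrite AE; apply: f4.
- by rewrite -mulrA thetaME dthetaME SDscalE eqxx mulr1n.
- by rewrite -mulrA dthetaME thetaME SDscalE eqxx mulr1n.
- by rewrite thetaME SDscalE.
- by rewrite dthetaME SDscalE.
Qed.

Lemma theta_sq : theta * theta = 0 :> SD C.
Proof. exact: mul_delta_mx_0. Qed.
Lemma dtheta_sq : dtheta * dtheta = 0 :> SD C.
Proof. exact: mul_delta_mx_0. Qed.
Lemma theta_comm g : theta * SDscal g = SDscal g * theta.
Proof. by apply: SDscal_comm => i j; rewrite thetaE commr_nat. Qed.
Lemma dtheta_comm g : dtheta * SDscal g = SDscal g * dtheta.
Proof. by apply: SDscal_comm => i j; rewrite dthetaE commr_nat. Qed.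

Lemma SDscal_sum g :
  SDscal g = \sum_(k <- msupp g) tpow k * horner_alg Dop g@_k.
Proof.
rewrite [in LHS](LD_sumE g) /SDscal raddf_sum; apply: eq_bigr => k _.
by rewrite horner_Dop -SDscalM LDmonM shiftp1 mul1r addr0.
Qed.

(* The basis t^k D^l {theta d_theta, d_theta theta, theta, d_theta}: the entries
   of e are its coordinates, and SDscal_sum writes each as a sum of t^k f(D). *)
Lemma SD_expand (e : SD C) :
  e = theta * dtheta * SDscal (e 0 0) + dtheta * theta * SDscal (e 1 1)
      + theta * SDscal (e 0 1) + dtheta * SDscal (e 1 0).
Proof.
by apply: SD_eqP; rewrite unit_entry /= ?mulr1n ?mulr0n ?addr0 ?add0r.
Qed.

Lemma theta_dtheta : theta * dtheta + dtheta * theta = 1 :> SD C.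
Proof.
have SD1E i j : (1 : SD C) i j = (i == j)%:R by exact: mxE.
rewrite [RHS]SD_expand !SD1E /= mulr0n mulr1n.
have -> : SDscal (1 : LD C) = 1 by exact: tpow0.
have -> : SDscal (0 : LD C) = 0 by exact: raddf0.
by rewrite !mulr1 !mulr0 !addr0.
Qed.

End Relations.

Section Gradings.
Variable C : comNzRingType.

(* E_ij is even (theta d_theta, d_theta theta) iff i = j. *)
Definition SD_parity (p : bool) : set (SD C) :=
  [set e | forall i j : 'I_2, e i j != 0 -> (i != j) = p].

(* The weight of E_ij: 1/2 for theta = E_01, -1/2 for d_theta = E_10. *)
Definition wt_unit (i j : 'I_2) : rat := ((j : nat)%:Q - (i : nat)%:Q) / 2.

(* The principal gradation, with degrees in (1/2)Z taken in rat. *)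
Definition SD_deg (d : rat) : set (SD C) :=
  [set e | forall (i j : 'I_2) (k : int),
     (e i j)@_k != 0 -> k%:Q + wt_unit i j = d].

Lemma SD_parityE (p : bool) (x : SD C) (i j : 'I_2) :
  SD_parity p x -> (i != j) != p -> x i j = 0.
Proof. by move=> xp ijp; apply/eqP; apply: contraNT ijp => /xp ->. Qed.

Lemma SD_degM d1 d2 x y :
  SD_deg d1 x -> SD_deg d2 y -> SD_deg (d1 + d2) (x * y).
Proof.
move=> xd yd i j m.
have LD_coefM (g1 g2 : LD C) : (g1 * g2)@_m != 0 ->
    exists k l, [/\ g1@_k != 0, g2@_l != 0 & k + l = m].
  rewrite [g1 * g2]/(LD_mul g1 g2) /LD_mul.
  have addP (u v : LD C) : ((u@_m != 0) -> exists k l,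
      [/\ g1@_k != 0, g2@_l != 0 & k + l = m]) -> ((v@_m != 0) -> exists k l,
      [/\ g1@_k != 0, g2@_l != 0 & k + l = m]) -> ((u + v)@_m != 0) ->
      exists k l, [/\ g1@_k != 0, g2@_l != 0 & k + l = m].
    move=> Hu Hv; rewrite mcoeffD; have [-> | u0 _] := eqVneq u@_m 0; last exact: Hu.
    by rewrite add0r.
  rewrite big_seq; elim/big_ind: _ => [|//|k kg1]; first by rewrite mcoeff0 eqxx.
  rewrite big_seq; elim/big_ind: _ => [|//|l lg2]; first by rewrite mcoeff0 eqxx.
  rewrite LDmonE; have [klm _|] := eqVneq (k + l) m; last by rewrite mulr0n eqxx.
  by exists k, l; rewrite !mcoeff_neq0.
have step n : (x i n * y n j)@_m != 0 -> m%:~R + wt_unit i j = d1 + d2.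
  move=> /LD_coefM[k [l [/xd <- /yd <- <-]]].
  rewrite rmorphD /= [RHS]addrACA /wt_unit -mulrDl; congr (_ + _ / _).
  by rewrite [RHS]addrC subrKA.
rewrite SD_mulE mcoeffD; have [->|/step//] := eqVneq (x i 0 * y 0 j)@_m 0.
by rewrite add0r => /step.
Qed.

Lemma tpow_deg k : SD_deg k%:~R (tpow k).
Proof.
move=> i j l; rewrite SDscalE; have [->|] := eqVneq i j.
  rewrite mulr1n LDmonE; have [<- _|] := eqVneq k l; last by rewrite eqxx.
  by rewrite /wt_unit subrr mul0r addr0.
by rewrite mulr0n mcoeff0 eqxx.
Qed.
Lemma Dop_deg : SD_deg 0 Dop.
Proof.
move=> i j l; rewrite SDscalE; have [->|] := eqVneq i j.
  rewrite mulr1n LDmonE; have [<- _|] := eqVneq 0 l; last by rewrite eqxx.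
  by rewrite /wt_unit subrr mul0r addr0.
by rewrite mulr0n mcoeff0 eqxx.
Qed.
Lemma theta_deg : SD_deg (1 / 2) theta.
Proof.
move=> i j l; rewrite thetaE; case: (eqVneq i) => [->|]; last by rewrite mcoeff0 eqxx.
case: (eqVneq j) => [->|]; last by rewrite mcoeff0 eqxx.
by rewrite [_@_l]LDmonE; have [<- _|] := eqVneq 0 l; rewrite ?eqxx.
Qed.
Lemma dtheta_deg : SD_deg (- (1 / 2)) dtheta.
Proof.
move=> i j l; rewrite dthetaE; case: (eqVneq i) => [->|]; last by rewrite mcoeff0 eqxx.
case: (eqVneq j) => [->|]; last by rewrite mcoeff0 eqxx.
by rewrite [_@_l]LDmonE; have [<- _|] := eqVneq 0 l; rewrite ?eqxx.
Qed.

(* sigma_{+-,a}; the value t^-1 |-> t^-1 is forced by the first two clauses. *)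
Definition is_sigma_pm (a : C) (s : {linear SD C -> SD C}) : Prop :=
  [/\ forall (p q : bool) (x y : SD C), SD_parity p x -> SD_parity q y ->
        s (x * y) = (-1) ^+ (p && q) *: (s y * s x),
      s (tpow 1) = tpow 1,
      s Dop = - Dop + a%:A,
      s theta = - theta
    & s dtheta = dtheta].

(* sigma_{+-,a} exists: on LD take the anti-automorphism tau with t |-> t,
   D |-> - D + a, and set sigma(e)_ij = +- tau(e_(1-j)(1-i)). *)
Section Tau.
Variable a : C.

Definition tau0 (f : {poly C}) : LD C := LDmon 0 (f \Po (a%:P - 'X)).

Lemma tau0_zmod : zmod_morphism tau0.
Proof. by move=> f g; rewrite /tau0 rmorphB; apply: monalgUB. Qed.

HB.instance Definition _ := GRing.isZmodMorphism.Build {poly C} (LD C) tau0 tau0_zmod.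

Let tau (g : LD C) : LD C := mmap tau0 (fun k => LDmon k 1) g.

Let tauD : {morph tau : g h / g + h}. Proof. exact: mmapD. Qed.
Let tau0E : tau 0 = 0. Proof. exact: mmap0. Qed.
Let tauU k f : tau (LDmon k f) = LDmon k (f \Po (a%:P - 'X - k%:~R)).
Proof.
rewrite /tau mmapU LDmonM add0r mulr1 /shiftp -comp_polyA; congr (LDmon k (f \Po _)).
by rewrite comp_polyB comp_polyC comp_polyX opprD addrA.
Qed.

Let tauM g h : tau (g * h) = tau h * tau g.
Proof.
elim/LD_ind: g => [|x y IHx IHy|k f]; first by rewrite !(mul0r, tau0E, mulr0).
- by rewrite !(mulrDl, mulrDr, tauD) IHx IHy.
elim/LD_ind: h => [|x y IHx IHy|l g]; first by rewrite !(mulr0, tau0E, mul0r).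
- by rewrite !(mulrDl, mulrDr, tauD) IHx IHy.
have intP (m : int) (q : {poly C}) : m%:~R \Po q = m%:~R by exact: rmorph_int.
rewrite LDmonM !tauU LDmonM [l + k]addrC comp_polyM mulrC /shiftp -!comp_polyA.
congr (LDmon _ _); congr (_ * _); congr (comp_poly _ _).
  rewrite 2!comp_polyB comp_polyC comp_polyX intP intrD.
  by rewrite [- ('X + _)]opprD [- (k%:~R + _)]opprD !addrA.
by rewrite comp_polyD comp_polyX intP intrD opprD addrA subrK.
Qed.

Let tauZ (c : C) g : tau (c *: g) = c *: tau g.
Proof.
elim/LD_ind: g => [|x y IHx IHy|k f]; first by rewrite !(scaler0, tau0E).
- by rewrite !(scalerDr, tauD) IHx IHy.
by rewrite LD_ZU !tauU LD_ZU comp_polyZ.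
Qed.

Lemma tau_exists : exists tau : LD C -> LD C,
  [/\ {morph tau : g h / g + h}, forall c, {morph tau : g / c *: g},
      forall g h, tau (g * h) = tau h * tau g &
      forall k f, tau (LDmon k f) = LDmon k (f \Po (a%:P - 'X - k%:~R))].
Proof. by exists tau. Qed.

End Tau.

Section Sigma.
Variables (a : C) (tau : LD C -> LD C).
Hypothesis tauD : {morph tau : g h / g + h}.
Hypothesis tauZ : forall c, {morph tau : g / c *: g}.
Hypothesis tauM : forall g h, tau (g * h) = tau h * tau g.
Hypothesis tauU : forall k f, tau (LDmon k f) = LDmon k (f \Po (a%:P - 'X - k%:~R)).

Let tau0E : tau 0 = 0. Proof. by have := tauZ 0 0; rewrite !scale0r. Qed.

Let sg (i j : 'I_2) : C := (-1) ^+ ((i == 0) && (j == 1)).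

Let sigma (e : SD C) : SD C :=
  \matrix_(i, j) (sg i j *: tau (e (rev_ord j) (rev_ord i))).

Let sigmaE e i j : sigma e i j = sg i j *: tau (e (rev_ord j) (rev_ord i)).
Proof. exact: mxE. Qed.

Let I2 (i : 'I_2) : i = 0 \/ i = 1.
Proof. by case: i => [[|[|//]] ?]; [left | right]; apply/val_inj. Qed.
Let rev0 : rev_ord 0 = 1 :> 'I_2. Proof. exact/val_inj. Qed.
Let rev1 : rev_ord 1 = 0 :> 'I_2. Proof. exact/val_inj. Qed.

Let sigma_linear : linear sigma.
Proof.
move=> c x y; apply/matrixP => i j.
have lin (u v : SD C) k l : (c *: u + v) k l = c *: u k l + v k l.
  by rewrite SD_addE SD_ZE.
apply: etrans (sigmaE _ _ _) _; rewrite lin tauD tauZ; apply: esym.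
apply: etrans (lin _ _ _ _) _; rewrite !sigmaE; apply: esym.
by rewrite scalerDr scalerA mulrC -scalerA.
Qed.

Let sigma_anti (p q : bool) (x y : SD C) : SD_parity p x -> SD_parity q y ->
  sigma (x * y) = (-1) ^+ (p && q) *: (sigma y * sigma x).
Proof.
move=> xp yq; apply/matrixP => i j.
have term k : sg i j *: (tau (y (rev_ord k) (rev_ord i))
                         * tau (x (rev_ord j) (rev_ord k))) =
    (-1) ^+ (p && q) *: (sg i k *: tau (y (rev_ord k) (rev_ord i))
                         * (sg k j *: tau (x (rev_ord j) (rev_ord k)))).
  have [kiq|/(SD_parityE yq) ->] := eqVneq (rev_ord k != rev_ord i) q; last first.
    by rewrite tau0E scaler0 !mul0r !scaler0.
  have [jkp|/(SD_parityE xp) ->] := eqVneq (rev_ord j != rev_ord k) p; last first.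
    by rewrite tau0E scaler0 !mulr0 !scaler0.
  rewrite -scalerAl -scalerAr !scalerA -kiq -jkp !(inj_eq rev_ord_inj) /sg.
  congr (_ *: _); rewrite -!signr_addb; congr (_ ^+ _).
  by case: (I2 i) => ->; case: (I2 j) => ->; case: (I2 k) => ->.
transitivity (sg i j *: tau (x (rev_ord j) 0 * y 0 (rev_ord i)
                             + x (rev_ord j) 1 * y 1 (rev_ord i))).
  by rewrite sigmaE SD_mulE.
transitivity ((-1) ^+ (p && q) *: (sigma y i 0 * sigma x 0 j
                                   + sigma y i 1 * sigma x 1 j)); last first.
  by apply/esym/(etrans (SD_ZE _ _ _ _)); rewrite SD_mulE.
have eR := f_equal2 +%R
  (f_equal2 *%R (sigmaE y i 0) (sigmaE x 0 j))
  (f_equal2 *%R (sigmaE y i 1) (sigmaE x 1 j)).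
apply: etrans _ (esym (congr1 ( *:%R _) eR)).
rewrite tauD !tauM !scalerDr addrC; apply: f_equal2.
  by have := term 0; rewrite rev0.
by have := term 1; rewrite rev1.
Qed.

Lemma sigma_pm_exists_of_tau :
  exists s : {linear SD C -> SD C}, is_sigma_pm a s.
Proof.
have scalE g i j : sigma (SDscal g) i j = tau g *+ (i == j).
  rewrite sigmaE SDscalE (inj_eq rev_ord_inj) eq_sym /sg.
  by case: (I2 i) => ->; case: (I2 j) => ->;
     rewrite /= ?mulr0n ?tau0E ?scaler0 ?mulr1n ?scale1r.
have tau1 : tau 1 = 1 by rewrite [LHS]tauU comp_polyC.
pose s : {linear SD C -> SD C} := HB.pack sigma
  (GRing.isLinear.Build C (SD C) (SD C) _ sigma sigma_linear).
exists s; split; first exact: sigma_anti.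
- apply/matrixP => i j; apply: etrans (scalE _ _ _) (esym _).
  by rewrite SDscalE tauU comp_polyC.
- apply/matrixP => i j; apply: etrans (scalE _ _ _) (esym _).
  rewrite SD_addE SD_oppE SDscalE SD_ZE [(1 : SD C) i j]SDscalE.
  case: (i == j); rewrite ?mulr1n ?mulr0n; last by rewrite oppr0 scaler0 addr0.
  rewrite tauU comp_polyX subr0 [LHS]addrC LDmonD [a *: _](LD_ZU a 0 1) alg_polyC.
  by congr (_ + _); exact/esym/monalgUN.
- apply/matrixP => i j; rewrite SD_oppE sigmaE !thetaE /sg.
  by case: (I2 i) => ->; case: (I2 j) => ->;
     rewrite /= ?tau0E ?tau1 ?scaler0 ?oppr0 ?scaleN1r.
apply/matrixP => i j; rewrite sigmaE !dthetaE /sg.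
by case: (I2 i) => ->; case: (I2 j) => ->;
   rewrite /= ?tau0E ?tau1 ?scaler0 ?scale1r.
Qed.

End Sigma.

Lemma sigma_pm_exists (a : C) : exists s : {linear SD C -> SD C}, is_sigma_pm a s.
Proof.
have [tau [tauD tauZ tauM tauU]] := tau_exists a.
exact: sigma_pm_exists_of_tau tauD tauZ tauM tauU.
Qed.


Definition SD_minus (s : SD C -> SD C) : set (SD C) := [set e | s e = - e].

Definition SD_minus_deg (s : SD C -> SD C) (d : rat) : set (SD C) :=
  (SD_minus s `&` SD_deg d)%classic.

Definition even_polynomial : set {poly C} := [set f | f \Po (- 'X) = f].
Definition odd_polynomial : set {poly C} := [set g | g \Po (- 'X) = - g].

End Gradings.

(* Main.v *)
Require Import Defs.
From mathcomp Require Import all_boot all_order all_algebra.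
From mathcomp Require Import monalg complex ring lra zify.
From mathcomp Require Import boolp classical_sets reals.

Set Implicit Arguments.
Unset Strict Implicit.
Unset Printing Implicit Defensive.

Import GRing.Theory Num.Theory.
Local Open Scope ring_scope.
Local Open Scope classical_set_scope.
Local Open Scope complex_scope.

(** Every element is a 2 by 2 matrix over the Laurent differential operators,
    e = theta d_theta g1 + d_theta theta g2 + theta g3 + d_theta g4, and the
    whole proposition is read off from these four coordinates.

    Applying the anti-involution to t^k f(D) reverses the order of the factors,
    which gives f(a - D) t^k = t^k f(a - D - k): on the polynomial coefficient it
    is the substitution w |-> a - w - k ([reflect], [sigma_LDmon]), an involution.
    On the matrix units, the super sign makes sigma exchange theta d_theta and
    d_theta theta, while it negates theta and fixes d_theta.  So sigma e = - e
    decouples ([sigma_coord]) into g1 = - reflect g2 on the diagonal and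
    reflect g3 = g3, reflect g4 = - g4 off the diagonal.

    A weight j is only reached on the diagonal, with power t^j; a weight j - 1/2
    only off the diagonal, with t^(j-1) after theta and t^j after d_theta
    ([SD_deg_int], [SD_deg_half]).  In the first case g2 is free and determines
    g1, which is the first formula.  In the second, w |-> a - w - k is the
    reflection about the point - c with 2 c = k - a, so that moving the centre
    to 0 by w |-> w + c turns its invariant and anti-invariant polynomials into
    the even and odd ones ([reflect_fixed_recenter]); c is (j - a - 1) / 2 for
    k = j - 1 and (j - a) / 2 for k = j. *)

(** * Coordinates with respect to the matrix units *)

Section Coordinates.
Variable C : comNzRingType.
Implicit Types (f p q : {poly C}) (g : LD C) (e : SD C).

(** Coordinates are listed diagonal first, so that the two families of the
    proposition are the ones with the last two, or the first two, equal to 0. *)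
Definition SDcoord g1 g2 g3 g4 : SD C :=
  theta * dtheta * SDscal g1 + dtheta * theta * SDscal g2
  + theta * SDscal g3 + dtheta * SDscal g4.

Lemma eq_SDcoord e g1 g2 g3 g4 :
  e 0 0 = g1 -> e 1 1 = g2 -> e 0 1 = g3 -> e 1 0 = g4 ->
  e = SDcoord g1 g2 g3 g4.
Proof. by move=> <- <- <- <-; exact: SD_expand. Qed.

Lemma SDcoord_entries g1 g2 g3 g4 :
  [/\ SDcoord g1 g2 g3 g4 0 0 = g1, SDcoord g1 g2 g3 g4 1 1 = g2,
      SDcoord g1 g2 g3 g4 0 1 = g3 & SDcoord g1 g2 g3 g4 1 0 = g4].
Proof. by split; rewrite unit_entry /= ?mulr1n ?mulr0n ?addr0 ?add0r. Qed.

Lemma SDcoord_inj g1 g2 g3 g4 h1 h2 h3 h4 :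
  SDcoord g1 g2 g3 g4 = SDcoord h1 h2 h3 h4 ->
  [/\ g1 = h1, g2 = h2, g3 = h3 & g4 = h4].
Proof.
have [e00 e11 e01 e10] := SDcoord_entries g1 g2 g3 g4.
have [k00 k11 k01 k10] := SDcoord_entries h1 h2 h3 h4.
by move=> E; split;
  [rewrite -e00 E|rewrite -e11 E|rewrite -e01 E|rewrite -e10 E].
Qed.

Lemma SDscalN g : SDscal (- g) = - SDscal g.
Proof. exact: raddfN. Qed.

Lemma mulSDscal0 e : e * SDscal 0 = 0.
Proof. by have -> : SDscal (0 : LD C) = 0 by [exact: raddf0]; exact: mulr0. Qed.

Lemma SDcoord_diag g1 g2 :
  SDcoord g1 g2 0 0 = theta * dtheta * SDscal g1 + dtheta * theta * SDscal g2.
Proof.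
have add00 (x y z w : SD C) : z = 0 -> w = 0 -> x + y + z + w = x + y.
  by move=> -> ->; exact: etrans (addr0 _) (addr0 _).
exact: add00 (mulSDscal0 _) (mulSDscal0 _).
Qed.

Lemma SDcoord_offdiag g3 g4 :
  SDcoord 0 0 g3 g4 = theta * SDscal g3 + dtheta * SDscal g4.
Proof.
have add00 (x y z w : SD C) : x = 0 -> y = 0 -> x + y + z + w = z + w.
  by move=> -> ->; rewrite addr0 add0r.
exact: add00 (mulSDscal0 _) (mulSDscal0 _).
Qed.

Lemma SDcoordN g1 g2 g3 g4 :
  - SDcoord g1 g2 g3 g4 = SDcoord (- g1) (- g2) (- g3) (- g4).
Proof.
have [e00 e11 e01 e10] := SDcoord_entries g1 g2 g3 g4.
by apply: eq_SDcoord; rewrite SD_oppE ?e00 ?e11 ?e01 ?e10.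
Qed.

(** * Homogeneous elements of the principal gradation *)

Lemma LDmonN k f : LDmon k (- f) = - LDmon k f.
Proof. exact: monalgUN. Qed.

Lemma LDmon_inj k : injective (@LDmon C k).
Proof. by move=> f h /(congr1 (fun g : LD C => g@_k)); rewrite !LDmonE eqxx. Qed.

Lemma LDmon_homog g k : (forall l, g@_l != 0 -> l = k) -> g = LDmon k g@_k.
Proof.
move=> gk; apply/malgP => l; rewrite LDmonE.
have [<-|kl] := eqVneq k l; first by rewrite mulr1n.
by apply/eqP; apply: contraNT kl => /gk ->.
Qed.

Lemma LD_eq0 g : (forall l, g@_l = 0) -> g = 0.
Proof. by move=> g0; apply/malgP => l; rewrite g0 mcoeff0. Qed.

Lemma ord2_cases (i : 'I_2) : i = 0 \/ i = 1.
Proof. by case: i => [[|[|//]] ?]; [left | right]; apply/val_inj. Qed.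

Lemma wt_unit00 : wt_unit 0 0 = 0. Proof. by []. Qed.
Lemma wt_unit11 : wt_unit 1 1 = 0. Proof. by []. Qed.
Lemma wt_unit01 : wt_unit 0 1 = 1 / 2. Proof. by []. Qed.
Lemma wt_unit10 : wt_unit 1 0 = - (1 / 2). Proof. by []. Qed.

(** Integral weights live on the diagonal and the others off it; this is what
    keeps the two from mixing. *)
Lemma half_notint (k l : int) : k%:~R + 1 / 2 != l%:~R :> rat.
Proof.
apply/eqP => E.
have : (k * 2 + 1)%:~R = (l * 2)%:~R :> rat by rewrite !(intrM, intrD) -E; field.
by move=> /intr_inj; lia.
Qed.

Lemma SD_deg_int (j : int) e :
  SD_deg j%:~R e <-> exists f h, e = SDcoord (LDmon j f) (LDmon j h) 0 0.
Proof.
split=> [ej|[f [h ->]]].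
  exists (e 0 0)@_j, (e 1 1)@_j; apply: eq_SDcoord.
  - by apply: LDmon_homog => l /ej; rewrite wt_unit00 addr0 => /intr_inj.
  - by apply: LDmon_homog => l /ej; rewrite wt_unit11 addr0 => /intr_inj.
  - apply: LD_eq0 => l; apply/eqP; apply: contraT => /ej; rewrite wt_unit01.
    by move/eqP; rewrite (negbTE (half_notint _ _)).
  - apply: LD_eq0 => l; apply/eqP; apply: contraT => /ej; rewrite wt_unit10.
    by move/eqP; rewrite subr_eq eq_sym (negbTE (half_notint _ _)).
have [e00 e11 e01 e10] := SDcoord_entries (LDmon j f) (LDmon j h) 0 0.
move=> u v l; case: (ord2_cases u) => ->; case: (ord2_cases v) => ->;
  rewrite ?e00 ?e01 ?e10 ?e11 ?mcoeff0 ?eqxx // LDmonE.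
- by have [->|] := eqVneq j l; rewrite ?eqxx // wt_unit00 addr0.
- by have [->|] := eqVneq j l; rewrite ?eqxx // wt_unit11 addr0.
Qed.

Lemma SD_deg_half (j : int) e :
  SD_deg (j%:~R - 1 / 2) e <->
  exists p q, e = SDcoord 0 0 (LDmon (j - 1) p) (LDmon j q).
Proof.
have E1 (l : int) : l%:~R + 1 / 2 = j%:~R - 1 / 2 :> rat -> l = j - 1.
  by move=> E; apply: (@intr_inj rat); rewrite intrB; move: E; lra.
split=> [ej|[p [q ->]]].
  exists (e 0 1)@_(j - 1), (e 1 0)@_j; apply: eq_SDcoord.
  - apply: LD_eq0 => l; apply/eqP; apply: contraT => /ej; rewrite wt_unit00.
    by move/eqP; rewrite addr0 eq_sym subr_eq eq_sym (negbTE (half_notint _ _)).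
  - apply: LD_eq0 => l; apply/eqP; apply: contraT => /ej; rewrite wt_unit11.
    by move/eqP; rewrite addr0 eq_sym subr_eq eq_sym (negbTE (half_notint _ _)).
  - by apply: LDmon_homog => l /ej; rewrite wt_unit01 => /E1.
  - by apply: LDmon_homog => l /ej; rewrite wt_unit10 => /addIr/intr_inj.
have [e00 e11 e01 e10] := SDcoord_entries 0 0 (LDmon (j - 1) p) (LDmon j q).
move=> u v l; case: (ord2_cases u) => ->; case: (ord2_cases v) => ->;
  rewrite ?e00 ?e01 ?e10 ?e11 ?mcoeff0 ?eqxx // LDmonE.
- by have [<- _|] := eqVneq (j - 1) l; rewrite ?eqxx // wt_unit01 intrB; field.
- by have [->|] := eqVneq j l; rewrite ?eqxx // wt_unit10.
Qed.

(** * Reflected and recentred polynomials in D *)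

Lemma horner_alg_comp p f :
  horner_alg (horner_alg Dop p : SD C) f = horner_alg Dop (f \Po p).
Proof.
elim/poly_ind: f => [|f c IH]; first by rewrite comp_poly0 !rmorph0.
rewrite comp_polyD comp_polyM comp_polyX comp_polyC !rmorphD !rmorphM /= IH.
by rewrite !horner_algX !horner_algC.
Qed.

Lemma tpow_horner k f :
  tpow k * horner_alg Dop f = SDscal (LDmon k f) :> SD C.
Proof. by rewrite horner_Dop -SDscalM LDmonM shiftp1 mul1r addr0. Qed.

Lemma mul_tpow (x u : SD C) k g :
  tpow k * u = SDscal g -> x * tpow k * u = x * SDscal g.
Proof. by move=> <-; exact: esym (mulrA _ _ _). Qed.

Lemma tpow_horner_shift k (c : C) f :
  tpow k * horner_alg (Dop + c%:A) f = SDscal (LDmon k (f \Po ('X + c%:P))).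
Proof.
rewrite -tpow_horner -horner_alg_comp; congr (_ * horner_alg _ f).
by rewrite rmorphD /= horner_algX horner_algC.
Qed.

(** The effect of sigma on the coefficient of t^k: the shift by k comes from
    moving f(a - D) to the right of t^k. *)
Definition reflect (a : C) (k : int) f : {poly C} := f \Po (a%:P - 'X - k%:~R).

Lemma reflect0 a k : reflect a k 0 = 0.
Proof. exact: comp_poly0. Qed.

Lemma reflectN a k f : reflect a k (- f) = - reflect a k f.
Proof. exact: raddfN. Qed.

Lemma reflectK a k : involutive (reflect a k).
Proof.
move=> f; rewrite /reflect -comp_polyA !(comp_polyB, comp_polyC, comp_polyX) rmorph_int.
by rewrite (_ : _ - _ = 'X) ?comp_polyXr //; ring.
Qed.

Lemma tpow_horner_reflect a k f :
  tpow k * horner_alg (- Dop - k%:~R + a%:A) f = SDscal (LDmon k (reflect a k f)).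
Proof.
rewrite -tpow_horner -horner_alg_comp; congr (_ * horner_alg _ f).
rewrite !rmorphB /= horner_algX horner_algC rmorph_int.
by rewrite [RHS]addrAC [in RHS]addrC addrAC addrA.
Qed.

(** With 2 c = k - a, both sides substitute w |-> - w - c, since
    (a - w - k) + c = - w - c. *)
Lemma reflect_recenter a k c p : c *+ 2 = k%:~R - a ->
  reflect a k (p \Po ('X + c%:P)) = p \Po (- 'X) \Po ('X + c%:P).
Proof.
move=> ck; rewrite /reflect -!comp_polyA; congr (_ \Po _).
rewrite comp_polyD raddfN /= !comp_polyX comp_polyC.
have /(congr1 polyC) := ck; rewrite rmorphMn rmorphB /= rmorph_int => cP.
have -> : k%:~R = c%:P *+ 2 + a%:P by rewrite cP subrK.
ring.
Qed.

Lemma recenter_can c :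
  cancel (comp_poly ('X - c%:P)) (comp_poly ('X + c%:P) : {poly C} -> {poly C}).
Proof.
by move=> p; rewrite -comp_polyA comp_polyB comp_polyX comp_polyC addrK comp_polyXr.
Qed.

Lemma recenter_inj (c : C) : injective (comp_poly ('X + c%:P)).
Proof.
apply: (can_inj (g := comp_poly ('X - c%:P))) => p.
by rewrite -comp_polyA comp_polyD comp_polyX comp_polyC subrK comp_polyXr.
Qed.

(** The boolean is the parity, so that the even and the odd case are one
    argument: recentring conjugates [reflect] to w |-> - w, which commutes with
    the sign. *)
Lemma reflect_fixed_recenter (b : bool) a k c q : c *+ 2 = k%:~R - a ->
  reflect a k q = (-1) ^+ b *: q <->
  exists2 f, f \Po (- 'X) = (-1) ^+ b *: f & q = f \Po ('X + c%:P).
Proof.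
move=> ck; split=> [qb|[f fb ->]]; last by rewrite reflect_recenter // fb comp_polyZ.
exists (q \Po ('X - c%:P)); last by rewrite recenter_can.
by apply: (@recenter_inj c); rewrite -(reflect_recenter _ ck) comp_polyZ !recenter_can.
Qed.

End Coordinates.

(** * The anti-involution in coordinates *)

Section AntiInvolution.
Variables (C : comNzRingType) (a : C) (s : {linear SD C -> SD C}).
Hypothesis sP : is_sigma_pm a s.
Implicit Types (f p q : {poly C}) (g : LD C) (e : SD C).

Lemma SDscal_parity g : SD_parity false (SDscal g).
Proof. by move=> i j; rewrite SDscalE; case: (i == j); rewrite ?mulr0n ?eqxx. Qed.

Lemma theta_parity : SD_parity true (theta : SD C).
Proof. by move=> i j; case: (ord2_cases i) => ->; case: (ord2_cases j) => ->; rewrite thetaE ?eqxx. Qed.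

Lemma dtheta_parity : SD_parity true (dtheta : SD C).
Proof. by move=> i j; case: (ord2_cases i) => ->; case: (ord2_cases j) => ->; rewrite dthetaE ?eqxx. Qed.

(** Multiplying by an even element never produces a super sign, so on the scalar
    matrices sigma is a plain anti-automorphism. *)
Lemma sigmaM_even (b : bool) x g :
  SD_parity b x -> s (x * SDscal g) = s (SDscal g) * s x.
Proof.
by case: sP => sM _ _ _ _ xb; rewrite (sM _ _ _ _ xb (@SDscal_parity g)) andbF scale1r.
Qed.

Lemma sigmaM_scal g h : s (SDscal g * SDscal h) = s (SDscal h) * s (SDscal g).
Proof. exact: sigmaM_even _ (@SDscal_parity g). Qed.

(** The value at 1 is forced: t is fixed and invertible. *)
Lemma sigma1 : s 1 = 1.
Proof.
have [_ st _ _ _] := sP.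
have tt : tpow (-1) * tpow 1 = 1 :> SD C by rewrite -tpowD.
have tpow1_sigma1 : tpow 1 = tpow 1 * s 1.
  rewrite -{1}st -{1}[tpow 1]mul1r (sigmaM_even (b := false)) ?st //.
  exact: (@SDscal_parity 1).
by rewrite -[LHS]mul1r -[X in X * _]tt -mulrA -tpow1_sigma1 tt.
Qed.

Lemma sigma_tpow k : s (tpow k) = tpow k.
Proof.
have [_ st _ _ _] := sP.
have sD l m : s (tpow (l + m)) = s (tpow m) * s (tpow l).
  by rewrite tpowD (sigmaM_even _ (@SDscal_parity _)).
have sN : s (tpow (-1)) = tpow (-1).
  have : s (tpow (-1 + 1)) = 1 := sigma1.
  rewrite sD st => /(congr1 (fun x => tpow (-1) * x)).
  by rewrite mulrA -tpowD mul1r mulr1.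
elim/int_ind: k => [|n IH|n IH]; first exact: sigma1.
  by rewrite -addn1 PoszD sD IH st -tpowD addrC.
by rewrite -addn1 PoszD opprD sD IH sN -tpowD addrC.
Qed.

Lemma sigma_horner f :
  s (horner_alg Dop f) = horner_alg Dop (f \Po (a%:P - 'X)).
Proof.
have [_ _ sD _ _] := sP.
have sA (x y : SD C) : s (x + y) = s x + s y by exact: linearD.
have sC c : s c%:A = c%:A by rewrite linearZ /= sigma1.
have HA p q : horner_alg Dop (p + q) = horner_alg Dop p + horner_alg Dop q :> SD C.
  exact: rmorphD.
have HM p q : horner_alg Dop (p * q) = horner_alg Dop p * horner_alg Dop q :> SD C.
  exact: rmorphM.
have HC c : horner_alg Dop c%:P = c%:A :> SD C by exact: horner_algC.
have HX : horner_alg Dop 'X = Dop :> SD C by exact: horner_algX.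
have HR : horner_alg Dop (a%:P - 'X) = - Dop + a%:A :> SD C.
  by rewrite addrC rmorphD rmorphN /= horner_algX horner_algC.
elim/poly_ind: f => [|f c IH]; first by rewrite comp_poly0 rmorph0 linear0.
(* sigma reverses f(D) D, hence the commutation on the side of polynomials. *)
rewrite comp_polyD comp_polyM comp_polyX comp_polyC [(f \Po _) * _]mulrC.
rewrite !HA !HM HX HR !HC sA sC; congr (_ + _).
by rewrite horner_Dop sigmaM_scal sD -horner_Dop IH.
Qed.

Lemma sigma_LDmon k f :
  s (SDscal (LDmon k f)) = SDscal (LDmon k (reflect a k f)).
Proof.
rewrite -tpow_horner horner_Dop sigmaM_scal -horner_Dop sigma_horner sigma_tpow.
by rewrite horner_Dop -SDscalM LDmonM add0r mulr1 /shiftp /reflect -comp_polyA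
  comp_polyB comp_polyC comp_polyX opprD addrA.
Qed.

(** The super sign of two odd factors cancels the sign of sigma theta = - theta,
    so the diagonal matrix units are exchanged without a sign. *)
Lemma sigma_theta_dtheta : s (theta * dtheta) = dtheta * theta.
Proof.
have [sM _ _ st sd] := sP.
by rewrite (sM _ _ _ _ theta_parity dtheta_parity) st sd scaleN1r mulrN opprK.
Qed.

Lemma sigma_dtheta_theta : s (dtheta * theta) = theta * dtheta.
Proof.
have [sM _ _ st sd] := sP.
by rewrite (sM _ _ _ _ dtheta_parity theta_parity) st sd scaleN1r mulNr opprK.
Qed.

Lemma sigma_mul_LDmon (b : bool) x y k p :
  SD_parity b x -> s x = y -> (forall g, y * SDscal g = SDscal g * y) ->
  s (x * SDscal (LDmon k p)) = y * SDscal (LDmon k (reflect a k p)).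
Proof. by move=> xb sx yC; rewrite (sigmaM_even _ xb) sx sigma_LDmon yC. Qed.

Lemma sigma_coord k1 k2 k3 k4 p1 p2 p3 p4 :
  s (SDcoord (LDmon k1 p1) (LDmon k2 p2) (LDmon k3 p3) (LDmon k4 p4)) =
  SDcoord (LDmon k2 (reflect a k2 p2)) (LDmon k1 (reflect a k1 p1))
          (- LDmon k3 (reflect a k3 p3)) (LDmon k4 (reflect a k4 p4)).
Proof.
have [_ _ _ st sd] := sP.
have e00_parity : SD_parity false (theta * dtheta : SD C).
  by move=> i j; rewrite thetaME dthetaE; case: (ord2_cases i) => ->; case: (ord2_cases j) => ->;
    rewrite ?eqxx.
have e11_parity : SD_parity false (dtheta * theta : SD C).
  by move=> i j; rewrite dthetaME thetaE; case: (ord2_cases i) => ->; case: (ord2_cases j) => ->;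
    rewrite ?eqxx.
have sD4 (x y z w : SD C) : s (x + y + z + w) = s y + s x + s z + s w.
  by rewrite !linearD [s x + s y]addrC.
have f4 (x1 x2 x3 x4 y1 y2 y3 y4 : SD C) : x1 = y1 -> x2 = y2 -> x3 = y3 ->
  x4 = y4 -> x1 + x2 + x3 + x4 = y1 + y2 + y3 + y4 by move=> -> -> -> ->.
apply: etrans (sD4 _ _ _ _) _; apply: f4.
- apply: (sigma_mul_LDmon _ _ e11_parity sigma_dtheta_theta) => g.
  by rewrite -mulrA dtheta_comm !mulrA theta_comm.
- apply: (sigma_mul_LDmon _ _ e00_parity sigma_theta_dtheta) => g.
  by rewrite -mulrA theta_comm !mulrA dtheta_comm.
- have -> := sigma_mul_LDmon k3 p3 theta_parity st.
    by rewrite SDscalN mulrN mulNr.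
  by move=> g; rewrite mulNr mulrN theta_comm.
- exact: sigma_mul_LDmon dtheta_parity sd (@dtheta_comm _).
Qed.

(** * The fixed points of - sigma *)

(** The equation of the other diagonal coordinate, h = - reflect f, follows from
    this one because [reflect] is an involution. *)
Lemma SD_minus_diag j f h :
  SD_minus s (SDcoord (LDmon j f) (LDmon j h) 0 0) <-> f = - reflect a j h.
Proof.
have sE : s (SDcoord (LDmon j f) (LDmon j h) 0 0) =
    SDcoord (LDmon j (reflect a j h)) (LDmon j (reflect a j f)) 0 0.
  by have := sigma_coord j j 0 0 f h 0 0; rewrite !reflect0 !LDmon0 oppr0.
have mE : SD_minus s (SDcoord (LDmon j f) (LDmon j h) 0 0) =
    (SDcoord (LDmon j (reflect a j h)) (LDmon j (reflect a j f)) 0 0 =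
     SDcoord (LDmon j (- f)) (LDmon j (- h)) 0 0).
  by rewrite /SD_minus /= sE SDcoordN -!LDmonN oppr0.
rewrite mE; split=> [|->].
  by case/SDcoord_inj=> /LDmon_inj -> _ _ _; rewrite opprK.
have rE : reflect a j (- reflect a j h) = - h by rewrite reflectN reflectK.
by rewrite rE (opprK (reflect a j h)); reflexivity.
Qed.

Lemma SD_minus_offdiag k l p q :
  SD_minus s (SDcoord 0 0 (LDmon k p) (LDmon l q)) <->
  reflect a k p = p /\ reflect a l q = - q.
Proof.
have sE : s (SDcoord 0 0 (LDmon k p) (LDmon l q)) =
    SDcoord 0 0 (- LDmon k (reflect a k p)) (LDmon l (reflect a l q)).
  by have := sigma_coord 0 0 k l 0 0 p q; rewrite !reflect0 !LDmon0.
have mE : SD_minus s (SDcoord 0 0 (LDmon k p) (LDmon l q)) =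
    (SDcoord 0 0 (- LDmon k (reflect a k p)) (LDmon l (reflect a l q)) =
     SDcoord 0 0 (- LDmon k p) (LDmon l (- q))).
  by rewrite /SD_minus /= sE SDcoordN oppr0 -!LDmonN.
rewrite mE; split; last by case=> E1 E2; rewrite E1 E2; reflexivity.
by case/SDcoord_inj=> _ _ /oppr_inj/LDmon_inj-> /LDmon_inj->.
Qed.

Lemma SD_minus_deg_int (j : int) :
  SD_minus_deg s j%:~R =
    [set dtheta * theta * tpow j * horner_alg Dop f
         - theta * dtheta * tpow j * horner_alg (- Dop - j%:~R + a%:A) f
    | f in [set: {poly C}]].
Proof.
have coord f : dtheta * theta * tpow j * horner_alg Dop f
    - theta * dtheta * tpow j * horner_alg (- Dop - j%:~R + a%:A) f =
    SDcoord (LDmon j (- reflect a j f)) (LDmon j f) 0 0 :> SD C.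
  have e11 : dtheta * theta * tpow j * horner_alg Dop f =
      dtheta * theta * SDscal (LDmon j f).
    exact: mul_tpow _ (tpow_horner _ _).
  have e00 : theta * dtheta * tpow j * horner_alg (- Dop - j%:~R + a%:A) f =
      theta * dtheta * SDscal (LDmon j (reflect a j f)).
    exact: mul_tpow _ (tpow_horner_reflect _ _ _).
  have subE (x y z : SD C) : x - y * z = y * (- z) + x by rewrite mulrN addrC.
  have rN : SDscal (LDmon j (- reflect a j f)) = - SDscal (LDmon j (reflect a j f)).
    by rewrite LDmonN SDscalN.
  apply: etrans (f_equal2 (fun x y : SD C => x - y) e11 e00) (esym _).
  apply: etrans (SDcoord_diag _ _) _.
  by rewrite rN; exact: esym (subE _ _ _).
apply/seteqP; split=> [e [es /SD_deg_int[f [h eE]]]|e [h _ <-]].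
  have fE : f = - reflect a j h by move: es; rewrite eE => /SD_minus_diag.
  by exists h => //; rewrite eE fE; exact: coord.
rewrite (coord h); split; first exact/SD_minus_diag.
by apply/SD_deg_int; exists (- reflect a j h), h.
Qed.

(** The centres c and d are given by their doubles, since a
    commutative ring has no halves in general. *)
Lemma SD_minus_deg_half (j : int) (c d : C) :
  c *+ 2 = (j - 1)%:~R - a -> d *+ 2 = j%:~R - a ->
  SD_minus_deg s (j%:~R - 1 / 2) =
    [set e : SD C | exists f g : {poly C},
       [/\ even_polynomial f, odd_polynomial g &
           e = theta * tpow (j - 1) * horner_alg (Dop + c%:A) f
               + dtheta * tpow j * horner_alg (Dop + d%:A) g]].
Proof.
move=> cj dj.
have coord (f g : {poly C}) : theta * tpow (j - 1) * horner_alg (Dop + c%:A) f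
    + dtheta * tpow j * horner_alg (Dop + d%:A) g =
    SDcoord 0 0 (LDmon (j - 1) (f \Po ('X + c%:P)))
      (LDmon j (g \Po ('X + d%:P))) :> SD C.
  have e01 : theta * tpow (j - 1) * horner_alg (Dop + c%:A) f =
      theta * SDscal (LDmon (j - 1) (f \Po ('X + c%:P))).
    exact: mul_tpow _ (tpow_horner_shift _ _ _).
  have e10 : dtheta * tpow j * horner_alg (Dop + d%:A) g =
      dtheta * SDscal (LDmon j (g \Po ('X + d%:P))).
    exact: mul_tpow _ (tpow_horner_shift _ _ _).
  apply: etrans (f_equal2 (fun x y : SD C => x + y) e01 e10) (esym _).
  exact: SDcoord_offdiag.
have evenP p : reflect a (j - 1) p = p <->
    exists2 f, even_polynomial f & p = f \Po ('X + c%:P).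
  have := reflect_fixed_recenter false p cj; rewrite expr0 scale1r => ->.
  by split=> -[f fE ->]; exists f => //; move: fE; rewrite /even_polynomial /= scale1r.
have oddP q : reflect a j q = - q <->
    exists2 g, odd_polynomial g & q = g \Po ('X + d%:P).
  have := reflect_fixed_recenter true q dj; rewrite expr1 scaleN1r => ->.
  by split=> -[g gE ->]; exists g => //; move: gE; rewrite /odd_polynomial /= scaleN1r.
apply/seteqP; split=> [e [es /SD_deg_half[p [q eE]]]|e [f [g [fE gE ->]]]].
  move: es; rewrite eE => /SD_minus_offdiag[/evenP[f fE ->] /oddP[g gE ->]].
  by exists f, g; split; [exact: fE|exact: gE|exact: esym (coord f g)].
rewrite (coord f g); split; last by apply/SD_deg_half; do 2 eexists.
by apply/SD_minus_offdiag; split; [apply/evenP; exists f|apply/oddP; exists g].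
Qed.

End AntiInvolution.

Theorem proposition4p3 (R : realType) (a : R[i]) (j : int)
    (sigma : {linear SD R[i] -> SD R[i]}) (sigmaP : is_sigma_pm a sigma) :
  SD_minus_deg sigma j%:~R =
    [set dtheta * theta * tpow j * horner_alg Dop f
         - theta * dtheta * tpow j * horner_alg (- Dop - j%:~R + a%:A) f
    | f in [set: {poly R[i]}]]
  /\
  SD_minus_deg sigma (j%:~R - 1 / 2) =
    [set e : SD R[i] | exists f g : {poly R[i]},
       [/\ even_polynomial f, odd_polynomial g &
           e = theta * tpow (j - 1)
                 * horner_alg (Dop + ((j%:~R - a - 1) / 2)%:A) f
               + dtheta * tpow j
                 * horner_alg (Dop + ((j%:~R - a) / 2)%:A) g]].
Proof.
split; first exact: SD_minus_deg_int.
have halfK (x : R[i]) : (x / 2) *+ 2 = x by rewrite -mulr_natr divfK ?pnatr_eq0.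
have cE : ((j%:~R - a - 1) / 2) *+ 2 = (j - 1)%:~R - a.
  by rewrite halfK intrB addrAC.
exact: SD_minus_deg_half sigmaP _ _ _ cE (halfK _).
Qed.
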